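(* Let $f\in\mathbb H^{N_1\times N_2}$ be a quaternion-valued signal and let $\epsilon_1,\epsilon_2$ be integers. Then the DQQPFT of the modulated signal $e^{i\frac{2\pi}{N_1}\epsilon_1\xi_1}f(\xi_1,\xi_2)e^{j\frac{2\pi}{N_2}\epsilon_2\xi_2}$ is $$\mathcal Q^{\mathbb H}_{\mathfrak B_1\mathfrak B_2}\Big[e^{i\frac{2\pi}{N_1}\epsilon_1\xi_1}f(\xi_1,\xi_2)e^{j\frac{2\pi}{N_2}\epsilon_2\xi_2}\Big](\omega_1,\omega_2)=e^{i[c_1(\epsilon_1^2-2\omega_1\epsilon_1)\Delta u_1^2-e_1\epsilon_1\Delta u_1]}\,\mathcal Q^{\mathbb H}_{\mathfrak B_1\mathfrak B_2}[f](\omega_1-\epsilon_1,\omega_2-\epsilon_2)\,e^{j[c_2(\epsilon_2^2-2\omega_2\epsilon_2)\Delta u_2^2-e_2\epsilon_2\Delta u_2]}.$$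
   Context: $\mathbb H$ is the algebra of real quaternions with units $i,j,k$, $i^2=j^2=k^2=ijk=-1$, $ij=-ji=k$. Fix positive integers $N_1,N_2$. For $s=1,2$ let $\mathfrak B_s=(a_s,b_s,c_s,d_s,e_s)$ be real parameters with $b_s\neq 0$, let $\Delta t_s>0$ be a sampling interval and $\Delta u_s=2\pi b_s/(N_s\Delta t_s)$. A signal $f\in\mathbb H^{N_1\times N_2}$ is an array of quaternions $f(\xi_1,\xi_2)$, $\xi_s\in\{0,\dots,N_s-1\}$. Its two-sided discrete quaternion quadratic phase Fourier transform (DQQPFT) is $$\mathcal Q^{\mathbb H}_{\mathfrak B_1\mathfrak B_2}[f](\omega_1,\omega_2)=\frac1{\sqrt{N_1N_2}}\sum_{\xi_1=0}^{N_1-1}\sum_{\xi_2=0}^{N_2-1}e^{-i(a_1\xi_1^2\Delta t_1^2+\frac{2\pi}{N_1}\xi_1\omega_1+c_1\omega_1^2\Delta u_1^2+d_1\xi_1\Delta t_1+e_1\omega_1\Delta u_1)}f(\xi_1,\xi_2)\,e^{-j(a_2\xi_2^2\Delta t_2^2+\frac{2\pi}{N_2}\xi_2\omega_2+c_2\omega_2^2\Delta u_2^2+d_2\xi_2\Delta t_2+e_2\omega_2\Delta u_2)},$$ for $\omega_s\in\{0,\dots,N_s-1\}$, where for real $x$, $e^{\pm ix}=\cos x\pm i\sin x$ and $e^{\pm jx}=\cos x\pm j\sin x$. At other integer arguments such as $\omega_s-\epsilon_s$, $\mathcal Q^{\mathbb H}_{\mathfrak B_1\mathfrak B_2}[f]$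 is given by the same formula. *)

(* Defs.v *)
From HB Require Import structures.
From mathcomp Require Import all_boot all_order all_algebra.
From mathcomp Require Import reals trigo.
From mathcomp Require Import ring.

Set Implicit Arguments.
Unset Strict Implicit.
Unset Printing Implicit Defensive.

Import Order.TTheory GRing.Theory Num.Theory.
Local Open Scope ring_scope.

(* [Quaternion a b c d] is a + b i + c j + d k. *)
Record quaternion (R : Type) : Type :=
  Quaternion { qre : R; qim_i : R; qim_j : R; qim_k : R }.

Definition prod_of_quaternion (R : Type) (x : quaternion R) :=
  (qre x, qim_i x, qim_j x, qim_k x).

Definition quaternion_of_prod (R : Type) (p : R * R * R * R) : quaternion R :=
  let: (a, b, c, d) := p in Quaternion a b c d.

Lemma prod_of_quaternionK (R : Type) :
  cancel (@prod_of_quaternion R) (@quaternion_of_prod R).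
Proof. by case. Qed.

HB.instance Definition _ (R : eqType) :=
  Equality.copy (quaternion R) (can_type (@prod_of_quaternionK R)).
HB.instance Definition _ (R : choiceType) :=
  Choice.copy (quaternion R) (can_type (@prod_of_quaternionK R)).

Section QuaternionAlgebra.
Variable R : comNzRingType.
Implicit Types (x y z : quaternion R) (t u : R).

Definition addq x y : quaternion R :=
  let: Quaternion a1 b1 c1 d1 := x in
  let: Quaternion a2 b2 c2 d2 := y in
  Quaternion (a1 + a2) (b1 + b2) (c1 + c2) (d1 + d2).

Definition oppq x : quaternion R :=
  let: Quaternion a b c d := x in Quaternion (- a) (- b) (- c) (- d).

Definition scaleq t x : quaternion R :=
  let: Quaternion a b c d := x in Quaternion (t * a) (t * b) (t * c) (t * d).

Definition mulq x y : quaternion R :=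
  let: Quaternion a1 b1 c1 d1 := x in
  let: Quaternion a2 b2 c2 d2 := y in
  Quaternion
    (a1 * a2 - b1 * b2 - c1 * c2 - d1 * d2)
    (a1 * b2 + b1 * a2 + c1 * d2 - d1 * c2)
    (a1 * c2 - b1 * d2 + c1 * a2 + d1 * b2)
    (a1 * d2 + b1 * c2 - c1 * b2 + d1 * a2).

Let zeroq : quaternion R := Quaternion 0 0 0 0.
Let oneq : quaternion R := Quaternion 1 0 0 0.

Fact addqA : associative addq.
Proof. by case=> ? ? ? ? [? ? ? ?] [? ? ? ?]; rewrite /= !addrA. Qed.

Fact addqC : commutative addq.
Proof.
by case=> a b c d [a' b' c' d'] /=; congr Quaternion; rewrite addrC.
Qed.

Fact add0q : left_id zeroq addq.
Proof. by case=> ? ? ? ?; rewrite /= !add0r. Qed.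

Fact addNq : left_inverse zeroq oppq addq.
Proof. by case=> ? ? ? ?; rewrite /= !addNr. Qed.

HB.instance Definition _ :=
  GRing.isZmodule.Build (quaternion R) addqA addqC add0q addNq.

Fact mulqA : associative mulq.
Proof.
by case=> ? ? ? ? [? ? ? ?] [? ? ? ?] /=; congr Quaternion; ring.
Qed.

Fact mul1q : left_id oneq mulq.
Proof. by case=> ? ? ? ? /=; congr Quaternion; ring. Qed.

Fact mulq1 : right_id oneq mulq.
Proof. by case=> ? ? ? ? /=; congr Quaternion; ring. Qed.

Fact mulqDl : left_distributive mulq addq.
Proof.
by case=> ? ? ? ? [? ? ? ?] [? ? ? ?] /=; congr Quaternion; ring.
Qed.

Fact mulqDr : right_distributive mulq addq.
Proof.
by case=> ? ? ? ? [? ? ? ?] [? ? ? ?] /=; congr Quaternion; ring.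
Qed.

Fact oneq_neq0 : oneq != 0.
Proof. by apply/eqP => -[] /eqP; rewrite oner_eq0. Qed.

HB.instance Definition _ :=
  GRing.Zmodule_isNzRing.Build (quaternion R)
    mulqA mul1q mulq1 mulqDl mulqDr oneq_neq0.

Fact scaleqA t u x : scaleq t (scaleq u x) = scaleq (t * u) x.
Proof. by case: x => ? ? ? ?; rewrite /= !mulrA. Qed.

Fact scale1q : left_id 1 scaleq.
Proof. by case=> ? ? ? ?; rewrite /= !mul1r. Qed.

Fact scaleqDr : right_distributive scaleq +%R.
Proof. by move=> t [? ? ? ?] [? ? ? ?]; congr Quaternion; rewrite mulrDr. Qed.

Fact scaleqDl x : {morph scaleq^~ x : t u / t + u}.
Proof. by case: x => ? ? ? ? t u; congr Quaternion; rewrite mulrDl. Qed.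

HB.instance Definition _ :=
  GRing.Zmodule_isLmodule.Build R (quaternion R)
    scaleqA scale1q scaleqDr scaleqDl.

Fact scaleqAl t x y : t *: (x * y) = (t *: x) * y.
Proof.
by case: x y => ? ? ? ? [? ? ? ?]; congr Quaternion; rewrite /=; ring.
Qed.

HB.instance Definition _ :=
  GRing.Lmodule_isLalgebra.Build R (quaternion R) scaleqAl.

Fact scaleqAr t x y : t *: (x * y) = x * (t *: y).
Proof.
by case: x y => ? ? ? ? [? ? ? ?]; congr Quaternion; rewrite /=; ring.
Qed.

HB.instance Definition _ :=
  GRing.Lalgebra_isAlgebra.Build R (quaternion R) scaleqAr.

Definition quat_i : quaternion R := Quaternion 0 1 0 0.
Definition quat_j : quaternion R := Quaternion 0 0 1 0.
Definition quat_k : quaternion R := Quaternion 0 0 0 1.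

Lemma quaternionE x :
  x = qre x *: 1 + qim_i x *: quat_i + qim_j x *: quat_j + qim_k x *: quat_k.
Proof. by case: x => a b c d; congr Quaternion; rewrite /=; ring. Qed.

Lemma quat_ii : quat_i * quat_i = -1.
Proof. by congr Quaternion; ring. Qed.

Lemma quat_jj : quat_j * quat_j = -1.
Proof. by congr Quaternion; ring. Qed.

Lemma quat_kk : quat_k * quat_k = -1.
Proof. by congr Quaternion; ring. Qed.

Lemma quat_ijk : quat_i * quat_j * quat_k = -1.
Proof. by congr Quaternion; rewrite /=; ring. Qed.

Lemma quat_ij : quat_i * quat_j = quat_k.
Proof. by congr Quaternion; ring. Qed.

Lemma quat_ji : quat_j * quat_i = - quat_k.
Proof. by congr Quaternion; ring. Qed.

End QuaternionAlgebra.

Arguments quat_i {R}.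
Arguments quat_j {R}.
Arguments quat_k {R}.

(* e^{mu x} = cos x + mu sin x; used for mu = i and mu = j. *)
Definition qexp (R : realType) (mu : quaternion R) (x : R) : quaternion R :=
  cos x *: 1 + sin x *: mu.

(* The real parameters (a, b, c, d, e) of a quadratic phase kernel. *)
Record qpParams (R : Type) : Type :=
  QPParams { qpa : R; qpb : R; qpc : R; qpd : R; qpe : R }.

(* The spectral sampling step 2 pi b / (N dt) attached to the time step dt. *)
Definition qpdu (R : realType) (B : qpParams R) (N : nat) (dt : R) : R :=
  2 * pi * qpb B / (N%:R * dt).

Definition qpPhase (R : realType) (B : qpParams R) (N : nat) (dt : R)
    (xi : nat) (w : int) : R :=
  let du := qpdu B N dt in
  qpa B * xi%:R ^+ 2 * dt ^+ 2 + 2 * pi / N%:R * xi%:R * w%:~R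
  + qpc B * w%:~R ^+ 2 * du ^+ 2 + qpd B * xi%:R * dt + qpe B * w%:~R * du.

(* The transform is evaluated at arbitrary integer frequencies, the output not
   being N-periodic in general. *)
Definition DQQPFT (R : realType) (N1 N2 : nat) (B1 B2 : qpParams R)
    (dt1 dt2 : R) (f : 'M[quaternion R]_(N1, N2)) (w1 w2 : int) :
    quaternion R :=
  (Num.sqrt (N1 * N2)%:R)^-1 *:
    \sum_(xi1 < N1) \sum_(xi2 < N2)
      qexp quat_i (- qpPhase B1 N1 dt1 xi1 w1)
      * f xi1 xi2
      * qexp quat_j (- qpPhase B2 N2 dt2 xi2 w2).

(* Main.v *)
Require Import Defs.
From mathcomp Require Import all_boot all_order all_algebra.
From mathcomp Require Import reals trigo.
From mathcomp Require Import ring.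
Import GRing.Theory Num.Theory.
Local Open Scope ring_scope.

(** For a unit [mu] with [mu * mu = -1], [qexp mu] turns sums of angles into
    products ([qexpD]), so the factors of the modulation merge with the kernels
    of the transform, each on its own side of the signal: the exponentials along
    [quat_i] meet only on the left of [f], those along [quat_j] only on its
    right, and noncommutativity never intervenes.  What remains is real
    arithmetic ([qpPhase_modulation]): the modulation turns the linear term in
    [xi * w] into that of the frequency [w - eps], and completing the other
    terms of the phase to those of [w - eps] costs an angle that depends on the
    frequencies only.  The corresponding exponential therefore factors out of
    the double sum. *)

(** The addition formulas for [cos] and [sin]; [mu * mu = -1] supplies the sign
    of the product of sines. *)
Lemma qexpD (R : realType) (mu : quaternion R) (x y : R) :
  mu * mu = -1 -> qexp mu (x + y) = qexp mu x * qexp mu y.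
Proof.
move=> mu2; rewrite /qexp cosD sinD mulrDl !mulrDr.
rewrite -!scalerAl -!scalerAr !mul1r mulr1 mu2 !scalerA.
rewrite scalerN scalerBl scalerDl [in RHS](addrC (_ *: mu)) [in RHS]addrACA.
by rewrite [X in _ = _ + X]addrC.
Qed.

(** The modulation turns the term of the phase in [xi * w] into the one at
    [w - eps].  The angle on the right is the change, from [w] to [w - eps], of
    the terms in [qpc] and [qpe], the others that see the frequency; it is
    independent of [xi]. *)
Lemma qpPhase_modulation (R : realType) (B : qpParams R) (N : nat) (dt : R)
    (xi : nat) (w eps : int) :
  2 * pi / N%:R * eps%:~R * xi%:R - qpPhase B N dt xi w
  = (qpc B * (eps%:~R ^+ 2 - 2 * w%:~R * eps%:~R) * qpdu B N dt ^+ 2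
     - qpe B * eps%:~R * qpdu B N dt) - qpPhase B N dt xi (w - eps).
Proof. by rewrite /qpPhase intrB; ring. Qed.

Theorem theorem3p5 (R : realType) (N1 N2 : nat)
  (hN1 : (0 < N1)%N) (hN2 : (0 < N2)%N)
  (B1 B2 : qpParams R) (hb1 : qpb B1 != 0) (hb2 : qpb B2 != 0)
  (dt1 dt2 : R) (hdt1 : 0 < dt1) (hdt2 : 0 < dt2)
  (f : 'M[quaternion R]_(N1, N2)) (eps1 eps2 : int)
  (w1 : 'I_N1) (w2 : 'I_N2) :
  let du1 := qpdu B1 N1 dt1 in
  let du2 := qpdu B2 N2 dt2 in
  DQQPFT B1 B2 dt1 dt2
    (\matrix_(xi1 < N1, xi2 < N2)
       (qexp quat_i (2 * pi / N1%:R * eps1%:~R * xi1%:R)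
        * f xi1 xi2
        * qexp quat_j (2 * pi / N2%:R * eps2%:~R * xi2%:R)))
    w1%:Z w2%:Z
  = qexp quat_i
      (qpc B1 * (eps1%:~R ^+ 2 - 2 * w1%:R * eps1%:~R) * du1 ^+ 2
       - qpe B1 * eps1%:~R * du1)
    * DQQPFT B1 B2 dt1 dt2 f (w1%:Z - eps1) (w2%:Z - eps2)
    * qexp quat_j
        (qpc B2 * (eps2%:~R ^+ 2 - 2 * w2%:R * eps2%:~R) * du2 ^+ 2
         - qpe B2 * eps2%:~R * du2).
Proof.
move=> du1 du2; rewrite /DQQPFT -scalerAr -scalerAl; congr (_ *: _).
rewrite mulr_sumr mulr_suml; apply: eq_bigr => xi1 _.
rewrite mulr_sumr mulr_suml; apply: eq_bigr => xi2 _.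
rewrite mxE.
have regroup (l l' q r' r : quaternion R) :
  l * (l' * q * r') * r = l * l' * q * (r' * r) by rewrite !mulrA.
rewrite !regroup -!qexpD ?quat_ii ?quat_jj //.
(* The new factor is outermost on both sides: before the left kernel, but after
   the right one. *)
congr (qexp _ _ * _ * qexp _ _); first by rewrite addrC qpPhase_modulation.
by rewrite qpPhase_modulation addrC.
Qed.
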